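(* Let $w=w(a,b)$ be a good word. Then there is a polynomial $p_w\in\mathbb{Z}[x,z]$ such that for all $f,g\in\mathrm{Isom}^+(\mathbb{H}^3)$, with $\beta=\beta(f)$, $\gamma=\gamma(f,g)$ and $h=w(f,g)$, $$\gamma(f,h)=p_w(\beta,\gamma).$$ If $w$ is balanced, then $$p_w(x,z)=z(x-z)\big(x\,t_w^2(x,z)-(x+4)\,\omega_w^2(x,z)\big);$$ if $w$ is unbalanced, then $$p_w(x,z)=z\big(t_w^2(x,z)-x(x+4)\,\omega_w^2(x,z)\big),$$ where $t_w,\omega_w$ are the polynomials associated with $w$ defined in the context.
   Context: $\mathrm{Isom}^+(\mathbb{H}^3)\cong PSL(2,\mathbb{C})$; for isometries $f,g$ represented by $A,B\in SL(2,\mathbb{C})$, $\beta(f)=\mathrm{tr}^2(A)-4$ and $\gamma(f,g)=\mathrm{tr}(ABA^{-1}B^{-1})-2$. Square roots are principal. Good words: a good word is $b^{s_1}a^{r_1}b^{s_2}\cdots a^{r_{m-1}}b^{s_m}$ with $s_1=\pm1$, $s_j=(-1)^{j+1}s_1$, $r_j\in\mathbb{Z}$ (possibly $0$); it is even if $\sum r_j$ is even and odd otherwise, balanced if $m$ is even and unbalanced otherwise, regular if $s_1=1$ and irregular otherwise. Canonical matrices (case $\beta\ne0$) with parameters $(\beta,\beta',\gamma)$: $A=\mathrm{diag}\Big(\frac{\sqrt{\beta(\beta+4)}+\beta}{2\sqrt\beta},\frac{\sqrt{\beta(\beta+4)}-\beta}{2\sqrt\beta}\Big)$, $B=\begin{pmatrix}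 a & b \\ c & d \end{pmatrix}$ with $a=\frac12\big(\sqrt{\beta'+4}+\sqrt{(4\gamma+\beta\beta')/\beta}\big)$, $d=\frac12\big(\sqrt{\beta'+4}-\sqrt{(4\gamma+\beta\beta')/\beta}\big)$, and $c=-b=\sqrt{\gamma/\beta}$ if $\gamma\neq0$, while $(b,c)\in\{(0,1),(1,0),(0,0)\}$ if $\gamma=0$. Put $Q=\sqrt{\beta(\beta+4)}$. Polynomials $r_w,s_w,t_w,\omega_w$ in $\tfrac12\mathbb{Z}[x,z]$ associated with a good word $w$: - $w$ regular, even and balanced: they are the polynomials (which exist) such that for all $\beta\neq0,\beta',\gamma$, evaluating polynomials at $(x,z)=(\beta,\gamma)$, $w(A,B)=\begin{pmatrix} r_w+\frac{s_wQ}{\beta} & ab(\beta t_w+\omega_wQ) \\ {c}{d}(\beta t_w-\omega_wQ) & r_w-\frac{s_wQ}{\beta} \end{pmatrix}$. - $w$ regular, even and unbalanced: they are the polynomials (which exist) such that for all $\beta\ne0,\beta',\gamma$, $w(A,B)=\begin{pmatrix} a(r_w+s_wQ) & b(t_w+\omega_wQ) \\ c(t_w-\omega_wQ) & d(r_w-s_wQ) \end{pmatrix}$. - $w$ regular and odd: the polynomials of $w$ are defined to be those of the regular even word $wa$. - $w$ irregular: the polynomials of $w(a,b)$ are defined to be those of the regular word $w'(a,b)=w(a,b^{-1})$. *)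

(* Defs.v *)
From HB Require Import structures.
From mathcomp Require Import all_boot all_order all_fingroup all_algebra.
From mathcomp Require Import boolp classical_sets reals.
From mathcomp Require Import complex.
From mathcomp Require Import mpoly.
From mathcomp Require Import generic_quotient.
From mathcomp Require Import ring.

Set Implicit Arguments.
Unset Strict Implicit.
Unset Printing Implicit Defensive.

Import Order.TTheory GRing.Theory Num.Theory.

Local Open Scope ring_scope.

(* SL(2, F) as a [groupType]; the library's [{'GL_n[F]}] needs a finite ring. *)
Section SL2.
Variable F : fieldType.

Record SL2 := MkSL2 { SL2val :> 'M[F]_2; _ : \det SL2val == 1 }.

HB.instance Definition _ := [isSub for SL2val].
HB.instance Definition _ := [Choice of SL2 by <:].

Lemma det_SL2 (A : SL2) : \det (val A) = 1.
Proof. by case: A => M /= /eqP. Qed.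

Fact SL2_one_subproof : \det (1%:M : 'M[F]_2) == 1.
Proof. by rewrite det1. Qed.

Fact SL2_mul_subproof (A B : SL2) : \det (val A *m val B) == 1.
Proof. by rewrite det_mulmx !det_SL2 mulr1. Qed.

Fact SL2_inv_subproof (A : SL2) : \det (\adj (val A)) == 1.
Proof.
have := congr1 determinant (mul_mx_adj (val A)).
by rewrite det_mulmx det_SL2 mul1r det1 => ->.
Qed.

Definition SL2_one := MkSL2 SL2_one_subproof.
Definition SL2_mul A B := MkSL2 (SL2_mul_subproof A B).
Definition SL2_inv A := MkSL2 (SL2_inv_subproof A).

Fact SL2_mulA : associative SL2_mul.
Proof. by move=> A B C; apply: val_inj; rewrite /= mulmxA. Qed.
Fact SL2_mul1 : left_id SL2_one SL2_mul.
Proof. by move=> A; apply: val_inj; rewrite /= mul1mx. Qed.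
Fact SL2_1mul : right_id SL2_one SL2_mul.
Proof. by move=> A; apply: val_inj; rewrite /= mulmx1. Qed.
Fact SL2_mulV : left_inverse SL2_one SL2_inv SL2_mul.
Proof. by move=> A; apply: val_inj; rewrite /= mul_adj_mx det_SL2. Qed.
Fact SL2_Vmul : right_inverse SL2_one SL2_inv SL2_mul.
Proof. by move=> A; apply: val_inj; rewrite /= mul_mx_adj det_SL2. Qed.

HB.instance Definition _ :=
  isGroup.Build SL2 SL2_mulA SL2_mul1 SL2_1mul SL2_mulV SL2_Vmul.

Lemma SL2_valM (A B : SL2) : val (A * B)%g = val A *m val B.
Proof. by []. Qed.
Lemma SL2_valV (A : SL2) : val (A^-1)%g = \adj (val A).
Proof. by []. Qed.

Definition psl_equiv (A B : SL2) : bool :=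
  (val A == val B) || (val A == - val B).

Fact psl_equiv_refl : reflexive psl_equiv.
Proof. by move=> A; rewrite /psl_equiv eqxx. Qed.
Fact psl_equiv_sym : ssrbool.symmetric psl_equiv.
Proof.
by move=> A B; rewrite /psl_equiv [val A == val B]eq_sym -eqr_oppLR eq_sym
  [- val A == _]eq_sym.
Qed.
Fact psl_equiv_trans : transitive psl_equiv.
Proof.
move=> B A C; rewrite /psl_equiv.
by move=> /orP[]/eqP-> /orP[]/eqP->; rewrite ?opprK eqxx ?orbT.
Qed.

Canonical psl_equivRel :=
  EquivRel psl_equiv psl_equiv_refl psl_equiv_sym psl_equiv_trans.

End SL2.

(* PSL(2, F) = SL(2, F) / {1, -1}. *)
Section PSL2.
Variable F : fieldType.

Definition PSL2 := {eq_quot @psl_equiv F}%qT.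

HB.instance Definition _ := Choice.on PSL2.
HB.instance Definition _ := EqQuotient.on PSL2.

Implicit Types (A B C : SL2 F) (f g : PSL2).

Local Open Scope quotient_scope.

Definition psl (A : SL2 F) : PSL2 := \pi_PSL2 A.

Lemma psl_eqP A B : reflect (psl A = psl B) (psl_equiv A B).
Proof. by apply: (iffP idP) => /eqmodP. Qed.

Lemma psl_repr f : psl (repr f) = f.
Proof. exact: reprK. Qed.

Lemma repr_psl A : val (repr (psl A)) = val A \/ val (repr (psl A)) = - val A.
Proof.
by have /psl_eqP/orP[/eqP|/eqP] := psl_repr (psl A); [left|right].
Qed.

Definition PSL2_one : PSL2 := psl 1%g.
Definition PSL2_mul f g : PSL2 := psl (repr f * repr g)%g.
Definition PSL2_inv f : PSL2 := psl (repr f)^-1%g.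

Lemma PSL2_mulE A B : PSL2_mul (psl A) (psl B) = psl (A * B)%g.
Proof.
apply/psl_eqP; rewrite /psl_equiv !SL2_valM.
case: (repr_psl A) => ->; case: (repr_psl B) => ->;
by rewrite ?(mulNmx, mulmxN) ?opprK eqxx ?orbT.
Qed.

Lemma adj2N (M : 'M[F]_2) : \adj (- M) = - \adj M.
Proof. by rewrite -scaleN1r adjZ /= expr1 scaleN1r. Qed.

Lemma PSL2_invE A : PSL2_inv (psl A) = psl A^-1%g.
Proof.
apply/psl_eqP; rewrite /psl_equiv !SL2_valV.
by case: (repr_psl A) => ->; rewrite ?adj2N eqxx ?orbT.
Qed.

Fact PSL2_mulA : associative PSL2_mul.
Proof.
move=> f g h; rewrite -(psl_repr f) -(psl_repr g) -(psl_repr h).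
by rewrite !PSL2_mulE mulgA.
Qed.
Fact PSL2_mul1 : left_id PSL2_one PSL2_mul.
Proof. by move=> f; rewrite -(psl_repr f) PSL2_mulE mul1g. Qed.
Fact PSL2_1mul : right_id PSL2_one PSL2_mul.
Proof. by move=> f; rewrite -(psl_repr f) PSL2_mulE mulg1. Qed.
Fact PSL2_mulV : left_inverse PSL2_one PSL2_inv PSL2_mul.
Proof. by move=> f; rewrite -(psl_repr f) PSL2_invE PSL2_mulE mulVg. Qed.
Fact PSL2_Vmul : right_inverse PSL2_one PSL2_inv PSL2_mul.
Proof. by move=> f; rewrite -(psl_repr f) PSL2_invE PSL2_mulE mulgV. Qed.

HB.instance Definition _ :=
  isGroup.Build PSL2 PSL2_mulA PSL2_mul1 PSL2_1mul PSL2_mulV PSL2_Vmul.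

Definition sl_beta (A : SL2 F) : F := (\tr (val A)) ^+ 2 - 4%:R.
Definition sl_gamma (A B : SL2 F) : F := \tr (val (A * B * A^-1 * B^-1)%g) - 2%:R.

Definition psl_beta (f : PSL2) : F := sl_beta (repr f).
Definition psl_gamma (f g : PSL2) : F := sl_gamma (repr f) (repr g).

Lemma psl_betaE A : psl_beta (psl A) = sl_beta A.
Proof.
by rewrite /psl_beta /sl_beta; case: (repr_psl A) => ->; rewrite ?linearN ?sqrrN.
Qed.

Lemma psl_gammaE A B : psl_gamma (psl A) (psl B) = sl_gamma A B.
Proof.
rewrite /psl_gamma /sl_gamma !(SL2_valM, SL2_valV).
by case: (repr_psl A) => ->; case: (repr_psl B) => ->;
  rewrite ?adj2N ?(mulNmx, mulmxN, opprK).
Qed.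

End PSL2.

(* The orientation-preserving isometries of hyperbolic 3-space, through
   their identification with PSL(2, C), where C = R[i]. *)
Definition IsomH3 (R : realType) := PSL2 R[i].

Inductive letter := La | Lb.

(* A word is a sequence of powers of letters, read from left to right;
   zero exponents are allowed. *)
Definition word := seq (letter * int).

Definition expgz (G : groupType) (x : G) (n : int) : G :=
  match n with Posz k => (x ^+ k)%g | Negz k => (x ^- k.+1)%g end.

Fixpoint word_eval (G : groupType) (x y : G) (w : word) : G :=
  match w with
  | [::] => 1%g
  | (La, n) :: w' => (expgz x n * word_eval x y w')%g
  | (Lb, n) :: w' => (expgz y n * word_eval x y w')%g
  end.

(* The good word b^s_1 a^r_1 b^s_2 ... a^r_(m-1) b^s_m, as its first sign
   (s_1 = 1 iff [gw_regular]) and the list r_1, ..., r_(m-1). *)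
Record good_word := GoodWord { gw_regular : bool; gw_exps : seq int }.

Fixpoint gw_syllables (s : int) (rs : seq int) : word :=
  match rs with
  | [::] => [:: (Lb, s)]
  | r :: rs' => (Lb, s) :: (La, r) :: gw_syllables (- s) rs'
  end.

Definition gw_s1 (w : good_word) : int := if gw_regular w then 1 else -1.

Definition gw_word (w : good_word) : word := gw_syllables (gw_s1 w) (gw_exps w).

Definition gw_m (w : good_word) : nat := (size (gw_exps w)).+1.

Definition gw_balanced (w : good_word) : bool := ~~ odd (gw_m w).

Definition gw_even (w : good_word) : bool := (2 %| \sum_(r <- gw_exps w) r)%Z.

(* w(a, b^-1) *)
Definition gw_invb (w : good_word) : good_word :=
  GoodWord (~~ gw_regular w) (gw_exps w).

Definition gw_regularize (w : good_word) : good_word :=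
  if gw_regular w then w else gw_invb w.

(* w if w is even, and wa if w is odd. *)
Definition gw_even_word (w : good_word) : word :=
  if gw_even w then gw_word w else gw_word w ++ [:: (La, 1)].

(* [sqrtc] is the principal square root, unlike [sqrtC] of [numClosedFieldType],
   whose values have nonnegative imaginary part. *)
Section Canonical.
Variable R : realType.
Local Notation C := R[i].

Definition canonQ (beta : C) : C := sqrtc (beta * (beta + 4%:R)).

Definition mx2 (p q u v : C) : 'M[C]_2 :=
  \matrix_(i < 2, j < 2)
    if i == 0 then (if j == 0 then p else q) else (if j == 0 then u else v).

Definition canonA (beta : C) : 'M[C]_2 :=
  mx2 ((canonQ beta + beta) / (2%:R * sqrtc beta)) 0
      0 ((canonQ beta - beta) / (2%:R * sqrtc beta)).

Definition canon_a (beta beta' gamma : C) : C :=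
  (sqrtc (beta' + 4%:R) + sqrtc ((4%:R * gamma + beta * beta') / beta)) / 2%:R.

Definition canon_d (beta beta' gamma : C) : C :=
  (sqrtc (beta' + 4%:R) - sqrtc ((4%:R * gamma + beta * beta') / beta)) / 2%:R.

Definition canon_bc (beta gamma b c : C) : Prop :=
  if gamma == 0 then [\/ (b, c) = (0, 1), (b, c) = (1, 0) | (b, c) = (0, 0)]
  else c = sqrtc (gamma / beta) /\ b = - c.

Lemma det_mx2 p q u v : \det (mx2 p q u v) = p * v - q * u.
Proof.
rewrite (expand_det_row _ 0) !big_ord_recl big_ord0 addr0 /cofactor !det_mx11.
by rewrite !mxE /= expr0 expr1 !mul1r mulN1r mulrN.
Qed.

Lemma canon_bcE beta gamma b c :
  canon_bc beta gamma b c -> b * c = - (gamma / beta).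
Proof.
rewrite /canon_bc; case: (eqVneq gamma 0) => [->|_].
  by rewrite mul0r oppr0 => -[] [-> ->]; rewrite ?(mul0r, mulr0).
by move=> [-> ->]; rewrite mulNr -expr2 sqr_sqrtc.
Qed.

Lemma det_canonA beta : beta != 0 -> \det (canonA beta) = 1.
Proof.
move=> b0; have s0 : sqrtc beta != 0 by rewrite sqrtc_eq0.
have s2 := sqr_sqrtc beta; have q2 := sqr_sqrtc (beta * (beta + 4%:R)).
rewrite det_mx2 mulr0 subr0 mulf_div [X in X / _]mulrC -subr_sqr q2.
by rewrite mulrACA -[sqrtc beta * _]expr2 s2; field.
Qed.

Lemma det_canonB beta beta' gamma b c : beta != 0 -> canon_bc beta gamma b c ->
  \det (mx2 (canon_a beta beta' gamma) b c (canon_d beta beta' gamma)) = 1.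
Proof.
move=> b0 /canon_bcE bc; rewrite det_mx2 bc /canon_a /canon_d mulf_div.
by rewrite [X in X / _]mulrC -subr_sqr !sqr_sqrtc; field.
Qed.

End Canonical.

(* Bivariate polynomials in x and z: the indeterminates of index 0 and 1. *)
Definition xz_point (T : Type) (x z : T) : 'I_2 -> T :=
  fun i => if i == 0 then x else z.

Definition polX {S : nzRingType} : {mpoly S[2]} := 'X_(0 : 'I_2).
Definition polZ {S : nzRingType} : {mpoly S[2]} := 'X_(1 : 'I_2).

Definition evalQ (R : realType) (p : {mpoly rat[2]}) (x z : R[i]) : R[i] :=
  (map_mpoly (ratr : rat -> R[i]) p).@[xz_point x z].

Definition evalZ (R : realType) (p : {mpoly int[2]}) (x z : R[i]) : R[i] :=
  (map_mpoly (intr : int -> R[i]) p).@[xz_point x z].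

(* Membership in (1/2)Z[x, z]. *)
Definition half_integral (p : {mpoly rat[2]}) : Prop :=
  forall m, 2%:R * p@_m \is a Num.int.

Record word_polys := WordPolys {
  wp_r : {mpoly rat[2]};
  wp_s : {mpoly rat[2]};
  wp_t : {mpoly rat[2]};
  wp_omega : {mpoly rat[2]} }.

Definition wp_half_integral (P : word_polys) : Prop :=
  [/\ half_integral (wp_r P), half_integral (wp_s P),
      half_integral (wp_t P) & half_integral (wp_omega P)].

Section WordPolynomials.
Variable R : realType.
Local Notation C := R[i].

Definition balanced_mx (P : word_polys) (beta gamma a b c d : C) : 'M[C]_2 :=
  let Q := canonQ beta in
  let r := evalQ (wp_r P) beta gamma in
  let s := evalQ (wp_s P) beta gamma in
  let t := evalQ (wp_t P) beta gamma in
  let omega := evalQ (wp_omega P) beta gamma in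
  mx2 (r + s * Q / beta) (a * b * (beta * t + omega * Q))
      (c * d * (beta * t - omega * Q)) (r - s * Q / beta).

Definition unbalanced_mx (P : word_polys) (beta gamma a b c d : C) : 'M[C]_2 :=
  let Q := canonQ beta in
  let r := evalQ (wp_r P) beta gamma in
  let s := evalQ (wp_s P) beta gamma in
  let t := evalQ (wp_t P) beta gamma in
  let omega := evalQ (wp_omega P) beta gamma in
  mx2 (a * (r + s * Q)) (b * (t + omega * Q))
      (c * (t - omega * Q)) (d * (r - s * Q)).

(* The matrix identity characterizing the polynomials of a regular word w;
   [W] is w if w is even and wa if w is odd. *)
Definition represents (balanced : bool) (W : word) (P : word_polys) : Prop :=
  forall (beta beta' gamma b c : C) (A B : SL2 C),
    let a := canon_a beta beta' gamma in
    let d := canon_d beta beta' gamma in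
    beta != 0 -> canon_bc beta gamma b c ->
    val A = canonA beta -> val B = mx2 a b c d ->
    val (word_eval A B W) =
      if balanced then balanced_mx P beta gamma a b c d
      else unbalanced_mx P beta gamma a b c d.

Definition polys_spec (w : good_word) (P : word_polys) : Prop :=
  wp_half_integral P /\
  represents (gw_balanced w) (gw_even_word (gw_regularize w)) P.

(* The quadruple determined by [polys_spec]; the default value is returned only
   if no quadruple satisfies it. *)
Definition polys_of (w : good_word) : word_polys :=
  match pselect (exists P, polys_spec w P) with
  | left exP => projT1 (cid exP)
  | right _ => WordPolys 0 0 0 0
  end.

Definition t_of (w : good_word) : {mpoly rat[2]} := wp_t (polys_of w).
Definition omega_of (w : good_word) : {mpoly rat[2]} := wp_omega (polys_of w).

End WordPolynomials.

(* Main.v *)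
Require Import Defs.
From mathcomp Require Import all_boot all_order all_fingroup all_algebra.
From mathcomp Require Import reals complex mpoly.
From mathcomp Require Import boolp ring zify.
Import GRing.Theory.
Local Open Scope ring_scope.

Set Implicit Arguments.
Unset Strict Implicit.
Unset Printing Implicit Defensive.

(** Let A, B represent f, g, let C = B A B^-1, S = A^2 and K = A B A^-1 B^-1,
    and write x, z for beta(f), gamma(f, g).

    A regular balanced good word is C^r1 A^r2 C^r3 ..., a word in A and C, and
    an unbalanced one is such a word times B.  Words of even length in A and C
    involve only the products A^2, C A, A^-1 C, ..., and each of these is a
    combination of 1, S, K, S K with coefficients in Z[x, z].  By
    Cayley-Hamilton that span is stable under right multiplication by S and K
    ([comb_mul_sqr], [comb_mul_comm]), so it is a ring: the even word W attached
    to a good word is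
      W = q0 + q1 S + q2 K + q3 S K   or   W = (q0 + q1 S + q2 K + q3 S K) B
    with q0, ..., q3 in Z[x, z] that depend only on the word
    ([even_word_combP]).

    The trace polynomial comes from gamma(A, W) = - det (A W - W A).  Since S
    commutes with A, the bracket with W is an element e + f S times a bracket
    that is the same for all words, the one of A with K or the one of A with B
    ([lie_comb], [lie_comb_mulb]).  Taking determinants gives p_w in Z[x, z] as
    the norm e^2 + (x + 2) e f + f^2 times - z (x - z) or z.  This argument
    needs no diagonalization, hence holds for all f and g, parabolic ones
    included.

    For the canonical matrices, S is diagonal with entries (x + 2 + Q)/2 and
    (x + 2 - Q)/2, so the entries of W can be read off; this produces
    half-integral polynomials r, s, t, omega with the required matrix identity
    ([balanced_represents], [unbalanced_represents]), and hence [polys_of]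
    satisfies its specification.  Finally, any t and omega that satisfy the
    matrix identity determine gamma(A, W) as - beta times the product of the
    off-diagonal entries of W.  Both expressions for gamma(f, h) then agree for
    all beta != 0 and all gamma, hence agree as polynomials
    ([represents_gamma]). *)

(** * Two-by-two matrices and SL(2, C) *)

Section TwoByTwo.
Variable R : realType.
Local Notation C := R[i].
Implicit Types (A B : SL2 C) (M N : 'M[C]_2).

Lemma ord2P (i : 'I_2) : i = 0 \/ i = 1.
Proof. by case: i => [[|[|//]] ?]; [left | right]; apply/val_inj. Qed.

Lemma eq_mx22 M N :
  M 0 0 = N 0 0 -> M 0 1 = N 0 1 -> M 1 0 = N 1 0 -> M 1 1 = N 1 1 -> M = N.
Proof.
by move=> *; apply/matrixP => i j; case: (ord2P i) => ->; case: (ord2P j) => ->.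
Qed.

Lemma mx2_eta M : M = mx2 (M 0 0) (M 0 1) (M 1 0) (M 1 1).
Proof. by apply: eq_mx22; rewrite !mxE. Qed.

Lemma mul_mx2 (p q u v p' q' u' v' : C) :
  mx2 p q u v *m mx2 p' q' u' v' =
  mx2 (p * p' + q * u') (p * q' + q * v') (u * p' + v * u') (u * q' + v * v').
Proof.
by apply: eq_mx22; rewrite !mxE !big_ord_recl big_ord0 addr0 !mxE.
Qed.

Lemma add_mx2 (p q u v p' q' u' v' : C) :
  mx2 p q u v + mx2 p' q' u' v' = mx2 (p + p') (q + q') (u + u') (v + v').
Proof. by apply: eq_mx22; rewrite !mxE. Qed.

Lemma opp_mx2 (p q u v : C) : - mx2 p q u v = mx2 (- p) (- q) (- u) (- v).
Proof. by apply: eq_mx22; rewrite !mxE. Qed.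

Lemma scale_mx2 (k p q u v : C) :
  k *: mx2 p q u v = mx2 (k * p) (k * q) (k * u) (k * v).
Proof. by apply: eq_mx22; rewrite !mxE. Qed.

Lemma scalar_mx2 (k : C) : k%:M = mx2 k 0 0 k.
Proof. by apply: eq_mx22; rewrite !mxE. Qed.

Lemma tr_mx2 (p q u v : C) : \tr (mx2 p q u v) = p + v.
Proof. by rewrite /mxtrace !big_ord_recl big_ord0 addr0 !mxE. Qed.

Lemma adj_mx2 (p q u v : C) : \adj (mx2 p q u v) = mx2 v (- q) (- u) p.
Proof.
apply: eq_mx22; rewrite !mxE /cofactor !det_mx11 !mxE /=.
all: by rewrite ?(expr0, expr1, sqrrN, expr1n, mul1r, mulN1r).
Qed.

Definition mx2E :=
  (mul_mx2, add_mx2, opp_mx2, scale_mx2, scalar_mx2, adj_mx2).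

Lemma SL2_entries A :
  exists a b c d : C, val A = mx2 a b c d /\ a * d = 1 + b * c.
Proof.
exists (val A 0 0), (val A 0 1), (val A 1 0), (val A 1 1).
split; first exact: mx2_eta.
have/eqP := det_SL2 A.
by rewrite [X in \det X]mx2_eta det_mx2 subr_eq => /eqP.
Qed.

End TwoByTwo.

(** Replace elements of SL(2, C) by explicit entries; an identity between words
   becomes four polynomial identities modulo the determinant equations hA, hB,
   which are oriented so that they rewrite the product of the diagonal. *)
Ltac sl2_entries1 A :=
  have [? [? [? [? [-> hA]]]]] := SL2_entries A;
  rewrite !mx2E ?tr_mx2 ?det_mx2.

Ltac sl2_entries2 A B :=
  have [? [? [? [? [-> hA]]]]] := SL2_entries A;
  have [? [? [? [? [-> hB]]]]] := SL2_entries B;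
  rewrite !mx2E ?tr_mx2 ?det_mx2.

(** * The order spanned by 1, A^2, [A, B] and A^2 [A, B] *)

Section EvenOrder.
Variable R : realType.
Local Notation C := R[i].
Implicit Types (A B : SL2 C) (M : 'M[C]_2).

Definition sqr_mx A : 'M[C]_2 := val A *m val A.
Definition comm_mx A B : 'M[C]_2 :=
  val A *m val B *m \adj (val A) *m \adj (val B).

Definition comb A B (c0 c1 c2 c3 : C) : 'M[C]_2 :=
  c0%:M + c1 *: sqr_mx A + c2 *: comm_mx A B
    + c3 *: (sqr_mx A *m comm_mx A B).

Lemma combD A B c0 c1 c2 c3 d0 d1 d2 d3 :
  comb A B c0 c1 c2 c3 + comb A B d0 d1 d2 d3 =
  comb A B (c0 + d0) (c1 + d1) (c2 + d2) (c3 + d3).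
Proof.
rewrite /comb; move: (sqr_mx A *m comm_mx A B) => SK.
move: (sqr_mx A) (comm_mx A B) => S K.
rewrite [SK]mx2_eta [S]mx2_eta [K]mx2_eta !mx2E; congr (mx2 _ _ _ _); ring.
Qed.

Lemma combZ A B k c0 c1 c2 c3 :
  k *: comb A B c0 c1 c2 c3 = comb A B (k * c0) (k * c1) (k * c2) (k * c3).
Proof.
rewrite /comb; move: (sqr_mx A *m comm_mx A B) => SK.
move: (sqr_mx A) (comm_mx A B) => S K.
rewrite [SK]mx2_eta [S]mx2_eta [K]mx2_eta !mx2E; congr (mx2 _ _ _ _); ring.
Qed.

Lemma mul_comb M A B c0 c1 c2 c3 :
  M *m comb A B c0 c1 c2 c3 =
  c0 *: M + c1 *: (M *m sqr_mx A) + c2 *: (M *m comm_mx A B)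
    + c3 *: (M *m sqr_mx A *m comm_mx A B).
Proof.
rewrite /comb; move: (sqr_mx A) (comm_mx A B) => S K.
by rewrite !mulmxDr -!scalemxAr mulmxA mul_mx_scalar.
Qed.

(** Cayley-Hamilton gives S^2 = (x + 2) S - 1; its polarization expresses
    K S + S K through 1, S, K and the traces of S, K and S K, which are
    x + 2, z + 2 and (x + 3) (z + 2) - (x + 4). *)
Lemma comb_mul_sqr A B c0 c1 c2 c3 :
  let x := sl_beta A in let z := sl_gamma A B in
  comb A B c0 c1 c2 c3 *m sqr_mx A =
  comb A B
    (- c1 + (z - x - 2%:R) * c2 - (z + 2%:R) * c3)
    (c0 + (x + 2%:R) * c1 + (z + 2%:R) * c2
       + ((z + 2%:R) * (x + 2%:R) + z - x - 2%:R) * c3)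
    ((x + 2%:R) * c2 + c3) (- c2).
Proof.
rewrite /comb /comm_mx /sqr_mx /sl_gamma /sl_beta !SL2_valM !SL2_valV /=.
sl2_entries2 A B.
congr (mx2 _ _ _ _); ring: hA hB.
Qed.

Lemma comb_mul_comm A B c0 c1 c2 c3 :
  let z := sl_gamma A B in
  comb A B c0 c1 c2 c3 *m comm_mx A B =
  comb A B (- c2) (- c3) (c0 + (z + 2%:R) * c2) (c1 + (z + 2%:R) * c3).
Proof.
rewrite /comb /comm_mx /sqr_mx /sl_gamma /sl_beta !SL2_valM !SL2_valV /=.
sl2_entries2 A B.
congr (mx2 _ _ _ _); ring: hA hB.
Qed.

End EvenOrder.

(** * Evaluation of integral polynomials *)

Section EvalZ.
Variable R : realType.
Local Notation C := R[i].

Lemma evalZD p q (x z : C) : evalZ (p + q) x z = evalZ p x z + evalZ q x z.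
Proof. by rewrite /evalZ !rmorphD. Qed.

Lemma evalZN p (x z : C) : evalZ (- p) x z = - evalZ p x z.
Proof. by rewrite /evalZ !rmorphN. Qed.

Lemma evalZM p q (x z : C) : evalZ (p * q) x z = evalZ p x z * evalZ q x z.
Proof. by rewrite /evalZ !rmorphM. Qed.

Lemma evalZXn p n (x z : C) : evalZ (p ^+ n) x z = evalZ p x z ^+ n.
Proof. by rewrite /evalZ !rmorphXn. Qed.

Lemma evalZ_nat n (x z : C) : evalZ n%:R x z = n%:R.
Proof. by rewrite /evalZ !rmorph_nat. Qed.

Lemma evalZ0 (x z : C) : evalZ 0 x z = 0.
Proof. exact: evalZ_nat 0%N _ _. Qed.

Lemma evalZ1 (x z : C) : evalZ 1 x z = 1.
Proof. exact: evalZ_nat 1%N _ _. Qed.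

Lemma evalZX (x z : C) : evalZ polX x z = x.
Proof. by rewrite /evalZ map_mpolyX mevalXU. Qed.

Lemma evalZZ (x z : C) : evalZ polZ x z = z.
Proof. by rewrite /evalZ map_mpolyX mevalXU. Qed.

Definition evalZE :=
  (evalZD, evalZN, evalZM, evalZX, evalZZ, evalZ0, evalZ1, evalZ_nat).

End EvalZ.

(** * Families of matrices with coefficients in Z[x, z] *)

Section Integral.
Variable R : realType.
Local Notation C := R[i].
Implicit Types X Y : SL2 C -> SL2 C -> 'M[C]_2.

Definition integral X : Prop :=
  exists q0 q1 q2 q3 : {mpoly int[2]}, forall A B,
    let ev q := evalZ q (sl_beta A) (sl_gamma A B) in
    X A B = comb A B (ev q0) (ev q1) (ev q2) (ev q3).

Lemma eq_integral X Y : (forall A B, X A B = Y A B) -> integral Y -> integral X.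
Proof.
move=> eqXY [q0 [q1 [q2 [q3 hY]]]].
by exists q0, q1, q2, q3 => A B; rewrite eqXY hY.
Qed.

Lemma integralD X Y :
  integral X -> integral Y -> integral (fun A B => X A B + Y A B).
Proof.
move=> [p0 [p1 [p2 [p3 hX]]]] [q0 [q1 [q2 [q3 hY]]]].
exists (p0 + q0), (p1 + q1), (p2 + q2), (p3 + q3) => A B /=.
by rewrite hX hY combD !evalZD.
Qed.

Lemma integralZ (p : {mpoly int[2]}) X : integral X ->
  integral (fun A B => evalZ p (sl_beta A) (sl_gamma A B) *: X A B).
Proof.
move=> [q0 [q1 [q2 [q3 hX]]]].
exists (p * q0), (p * q1), (p * q2), (p * q3) => A B /=.
by rewrite hX combZ !evalZM.
Qed.

Lemma integral_mul_sqr X :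
  integral X -> integral (fun A B => X A B *m sqr_mx A).
Proof.
move=> [q0 [q1 [q2 [q3 hX]]]].
exists (- q1 + (polZ - polX - 2%:R) * q2 - (polZ + 2%:R) * q3).
exists (q0 + (polX + 2%:R) * q1 + (polZ + 2%:R) * q2
       + ((polZ + 2%:R) * (polX + 2%:R) + polZ - polX - 2%:R) * q3).
exists ((polX + 2%:R) * q2 + q3), (- q2) => A B /=.
by rewrite hX comb_mul_sqr !evalZE.
Qed.

Lemma integral_mul_comm X :
  integral X -> integral (fun A B => X A B *m comm_mx A B).
Proof.
move=> [q0 [q1 [q2 [q3 hX]]]].
exists (- q2), (- q3), (q0 + (polZ + 2%:R) * q2), (q1 + (polZ + 2%:R) * q3).
by move=> A B /=; rewrite hX comb_mul_comm !evalZE.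
Qed.

(** The span of 1, S, K, S K is closed under products because it is stable under
    right multiplication by S and by K, which generate it. *)
Lemma integralM X Y :
  integral X -> integral Y -> integral (fun A B => X A B *m Y A B).
Proof.
move=> iX [q0 [q1 [q2 [q3 hY]]]].
pose c q A B : C := evalZ q (sl_beta A) (sl_gamma A B).
apply: (@eq_integral _ (fun A B => c q0 A B *: X A B
  + c q1 A B *: (X A B *m sqr_mx A) + c q2 A B *: (X A B *m comm_mx A B)
  + c q3 A B *: (X A B *m sqr_mx A *m comm_mx A B))).
  by move=> A B; rewrite hY mul_comb.
have iS := integral_mul_sqr iX.
do !apply: integralD; apply: integralZ => //; exact: integral_mul_comm.
Qed.

(** The families that behave like words of even (e = false) or odd (e = true)
    length in A and C: A itself serves to make an odd family even. *)
Definition has_parity (e : bool) X : Prop :=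
  integral (fun A B => X A B *m (if e then val A else 1%:M)).

(** Exactly what is needed to multiply by L on the right and change parity:
    from an even X, the family X (L A) is even; from an odd X, so is
    X L = (X A) (A^-1 L). *)
Definition odd_letter (L : SL2 C -> SL2 C -> SL2 C) : Prop :=
  integral (fun A B => val (L A B * A)%g) /\
  integral (fun A B => val (A^-1 * L A B)%g).

Lemma parity_mul_letter e X (L : SL2 C -> SL2 C -> SL2 C) :
  odd_letter L -> has_parity e X ->
  has_parity (~~ e) (fun A B => X A B *m val (L A B)).
Proof.
case: e => -[iYA iAY] iX.
  apply: eq_integral (integralM iX iAY) => A B.
  by rewrite mulmx1 -mulmxA -SL2_valM mulgA mulgV mul1g.
apply: eq_integral (integralM iX iYA) => A B.
by rewrite mulmx1 SL2_valM mulmxA.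
Qed.

Lemma eq_parity e X Y :
  (forall A B, X A B = Y A B) -> has_parity e Y -> has_parity e X.
Proof. by move=> eqXY; apply: eq_integral => A B; rewrite eqXY. Qed.

Lemma parity_mul_letterX e X (L : SL2 C -> SL2 C -> SL2 C) n :
  odd_letter L -> has_parity e X ->
  has_parity (odd n (+) e) (fun A B => X A B *m val (L A B ^+ n)%g).
Proof.
move=> oY gX; elim: n => [|n IHn].
  by apply: eq_parity gX => A B; rewrite mulmx1.
rewrite /= addNb; apply: eq_parity (parity_mul_letter oY IHn) => A B.
by rewrite -mulmxA -SL2_valM -expgSr.
Qed.

Lemma odd_absz r : odd `|r| = ~~ (2 %| r)%Z.
Proof. by rewrite dvdzE /= dvdn2 negbK. Qed.

Lemma parity_mul_letterXz e X (L : SL2 C -> SL2 C -> SL2 C) (r : int) :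
  odd_letter L -> odd_letter (fun A B => (L A B)^-1%g) -> has_parity e X ->
  has_parity (~~ (2 %| r)%Z (+) e) (fun A B => X A B *m val (expgz (L A B) r)).
Proof.
rewrite -odd_absz => oY oV gX; case: r => n; first exact: parity_mul_letterX.
apply: eq_parity (parity_mul_letterX n.+1 oV gX) => A B.
by rewrite /expgz expgVn.
Qed.

Lemma odd_letter_a : odd_letter (fun A _ => A).
Proof.
split; last first.
  by exists 1, 0, 0, 0 => A B; rewrite mulVg /comb !evalZE !scale0r !addr0.
exists 0, 1, 0, 0 => A B; rewrite /comb !evalZE !scale0r scale1r !addr0.
by rewrite raddf0 add0r.
Qed.

Lemma odd_letter_aV : odd_letter (fun A _ => A^-1%g).
Proof.
split.
  by exists 1, 0, 0, 0 => A B; rewrite mulVg /comb !evalZE !scale0r !addr0.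
exists (polX + 2%:R), (-1), 0, 0 => A B.
rewrite /comb !evalZE !scale0r !addr0 /sqr_mx /sl_beta SL2_valM SL2_valV.
sl2_entries1 A; congr (mx2 _ _ _ _); ring: hA.
Qed.

(** C A = K^-1 S with K^-1 = (z + 2) - K, and A^-1 C = S^-1 (A C) with
    S^-1 = (x + 2) - S and A C = S + 1 - K. *)
Lemma odd_letter_c : odd_letter (fun A B => B * A * B^-1)%g.
Proof.
split.
  exists (polX + 2%:R - polZ), 0, (- (polX + 2%:R)), 1 => A B.
  rewrite /comb !evalZE /comm_mx /sqr_mx /sl_gamma /sl_beta.
  rewrite !SL2_valM !SL2_valV.
  sl2_entries2 A B; congr (mx2 _ _ _ _); ring: hA hB.
exists (polX + 3%:R), (-1), (- (polX + 2%:R)), 1 => A B.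
rewrite /comb !evalZE /comm_mx /sqr_mx /sl_gamma /sl_beta.
rewrite !SL2_valM !SL2_valV.
sl2_entries2 A B; congr (mx2 _ _ _ _); ring: hA hB.
Qed.

(** The coefficients follow from those of C, as C^-1 = tr A - C, where
    (tr A) A = S + 1 and (tr A) A^-1 = 1 + S^-1. *)
Lemma odd_letter_cV : odd_letter (fun A B => (B * A * B^-1)^-1)%g.
Proof.
split.
  exists (polZ - polX - 1), 1, (polX + 2%:R), (-1) => A B.
  rewrite /comb !evalZE /comm_mx /sqr_mx /sl_gamma /sl_beta.
  rewrite !invgM invgK !SL2_valM !SL2_valV.
  sl2_entries2 A B; congr (mx2 _ _ _ _); ring: hA hB.
exists 0, 0, (polX + 2%:R), (-1) => A B.
rewrite /comb !evalZE /comm_mx /sqr_mx /sl_gamma /sl_beta.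
rewrite !invgM invgK !SL2_valM !SL2_valV.
sl2_entries2 A B; congr (mx2 _ _ _ _); ring: hA hB.
Qed.

End Integral.

(** * Good words *)

Section GoodWords.
Variable R : realType.
Local Notation C := R[i].
Implicit Types X Y : SL2 C -> SL2 C -> 'M[C]_2.

Lemma not_even_addz (m n : int) :
  ~~ (2 %| m + n)%Z = ~~ (2 %| m)%Z (+) ~~ (2 %| n)%Z.
Proof.
case: (boolP (2 %| m)%Z); case: (boolP (2 %| n)%Z);
  case: (boolP (2 %| m + n)%Z) => //=; lia.
Qed.

Lemma word_eval_cat (G : groupType) (x y : G) u v :
  word_eval x y (u ++ v) = (word_eval x y u * word_eval x y v)%g.
Proof.
elim: u => [|[[] n] u IHu] /=; first by rewrite mul1g.
all: by rewrite IHu mulgA.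
Qed.

Lemma conj_expgz (G : groupType) (x y : G) n :
  (y * expgz x n = expgz (y * x * y^-1) n * y)%g.
Proof.
have conjX k : (y * x ^+ k = (y * x * y^-1) ^+ k * y)%g.
  elim: k => [|k IHk]; first by rewrite !expg0 mul1g mulg1.
  by rewrite !expgSr mulgA IHk -!mulgA mulVg mulg1.
case: n => k; first exact: conjX.
rewrite /expgz; apply: (mulgI ((y * x * y^-1) ^+ k.+1)%g).
by rewrite !mulgA -conjX mulgV mul1g -mulgA mulgV mulg1.
Qed.

(** Reading the word from the left, each b a^r is replaced by C^r b and the b is
    carried along until the next b^-1 cancels it.  For a word
    that starts with b^-1 (s = false) the induction therefore puts a pending b
    in front of it. *)
Lemma parity_good_word (s : bool) (rs : seq int) e X : has_parity e X ->
  exists2 Y, has_parity (~~ (2 %| \sum_(r <- rs) r)%Z (+) e) Y & forall A B,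
    X A B *m val ((if s then 1 else B) *
                  word_eval A B (gw_word (GoodWord s rs)))%g =
    Y A B *m val (if s (+) odd (size rs) then B else 1)%g.
Proof.
elim: rs s e X => [|r rs IHrs] s e X gX.
  exists X => [|A B]; first by rewrite big_nil.
  by congr (_ *m val _); case: s; rewrite /= ?expg1 mulg1 ?mul1g ?mulgV.
rewrite big_cons [size _]/=.
have [Y gY eY] : exists2 Y, has_parity (~~ (2 %| r)%Z (+) e) Y & forall A B,
    X A B *m val ((if s then 1 else B) *
                  word_eval A B (gw_word (GoodWord s (r :: rs))))%g =
    Y A B *m val ((if ~~ s then 1 else B) *
                  word_eval A B (gw_word (GoodWord (~~ s) rs)))%g.
  case: s.
    exists (fun A B => X A B *m val (expgz (B * A * B^-1) r)%g) => [|A B].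
      exact: (parity_mul_letterXz r (@odd_letter_c R) (@odd_letter_cV R) gX).
    rewrite -mulmxA -SL2_valM; congr (_ *m val _).
    by rewrite /= expg1 mul1g !mulgA -conj_expgz.
  exists (fun A B => X A B *m val (expgz A r)) => [|A B].
    exact: (parity_mul_letterXz r (@odd_letter_a R) (@odd_letter_aV R) gX).
  rewrite -mulmxA -SL2_valM; congr (_ *m val _).
  by rewrite /= expg1 !mulgA mulgV mul1g mulg1.
have [Z gZ eZ] := IHrs (~~ s) _ Y gY.
exists Z => [|A B]; first by rewrite not_even_addz addbAC addbC.
by rewrite eY eZ addNb addbN.
Qed.

Definition even_word_comb (w : good_word) (q0 q1 q2 q3 : {mpoly int[2]}) :=
  forall A B : SL2 C,
    let ev q := evalZ q (sl_beta A) (sl_gamma A B) in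
    val (word_eval A B (gw_even_word (gw_regularize w))) =
      comb A B (ev q0) (ev q1) (ev q2) (ev q3)
        *m (if gw_balanced w then 1%:M else val B).

Lemma even_word_combP w : exists q0 q1 q2 q3, even_word_comb w q0 q1 q2 q3.
Proof.
rewrite /even_word_comb.
have -> : gw_balanced w = gw_balanced (gw_regularize w).
  by rewrite /gw_regularize; case: ifP.
have : gw_regular (gw_regularize w).
  by rewrite /gw_regularize; case: ifP => //= ->.
case: (gw_regularize w) => _ rs /= ->.
have gr1 : has_parity false (fun _ _ : SL2 C => 1%:M).
  exists 1, 0, 0, 0 => A B; rewrite /comb !evalZE.
  by rewrite !scale0r !addr0 mulmx1.
have [Y gY eY] := parity_good_word true rs gr1.
have {}eY (A B : SL2 C) : val (word_eval A B (gw_word (GoodWord true rs))) =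
    Y A B *m val (if odd (size rs) then 1 else B)%g.
  by rewrite -if_neg -[RHS]eY mul1mx mul1g.
rewrite /gw_even_word /gw_even /gw_balanced /gw_m /= negbK.
(* In the unbalanced case the claim concerns W B^-1. *)
suff: integral (fun A B : SL2 C => val (word_eval A B
    (if (2 %| \sum_(r <- rs) r)%Z then gw_word (GoodWord true rs)
     else gw_word (GoodWord true rs) ++ [:: (La, 1)])) *m
     (if odd (size rs) then 1%:M else val B^-1%g)).
  move=> [q0 [q1 [q2 [q3 hq]]]]; exists q0, q1, q2, q3 => A B.
  rewrite -hq; case: (odd _); rewrite ?mulmx1 //.
  by rewrite -!SL2_valM mulgKV.
case: ifP gY => _; rewrite addbF => gY.
  apply: eq_integral gY => A B; rewrite eY.
  case: (odd _); first by rewrite mulmx1.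
  by rewrite -mulmxA -SL2_valM mulgV.
have evalwa (A B : SL2 C) :
    word_eval A B (gw_word (GoodWord true rs) ++ [:: (La, 1)]) =
    (word_eval A B (gw_word (GoodWord true rs)) * A)%g.
  by rewrite word_eval_cat /= expg1 mulg1.
case: (odd (size rs)) eY => eY.
  apply: eq_integral gY => A B.
  by rewrite evalwa SL2_valM eY !mulmx1.
(* A trailing b a is C b, so it is C, not a, that completes Y. *)
have gYC := parity_mul_letter (@odd_letter_c R) gY.
apply: eq_integral gYC => A B.
by rewrite evalwa SL2_valM eY mulmx1 -!mulmxA -!SL2_valM !mulgA.
Qed.

End GoodWords.

(** * The commutator trace of a word *)

Section Gamma.
Variable R : realType.
Local Notation C := R[i].
Implicit Types A B W : SL2 C.

(** det (A B - B A) = det (A B A^-1 B^-1 - 1), and det (M - 1) = 2 - tr M when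
    det M = 1.  Hence a factor M in front of the bracket A B - B A multiplies
    gamma by det M. *)
Lemma sl_gamma_det A B :
  sl_gamma A B = - \det (val A *m val B - val B *m val A).
Proof.
rewrite /sl_gamma !SL2_valM !SL2_valV.
sl2_entries2 A B; ring: hA hB.
Qed.

(** The norm form of Z[x][mu] with mu^2 = (x + 2) mu - 1, the characteristic
    equation of A^2 when x = beta. *)
Definition qnorm (x e f : C) : C := e ^+ 2 + (x + 2%:R) * e * f + f ^+ 2.

Lemma det_qnorm A e f :
  \det (e%:M + f *: sqr_mx A) = qnorm (sl_beta A) e f.
Proof.
rewrite /sqr_mx /sl_beta /qnorm.
sl2_entries1 A; ring: hA.
Qed.

Lemma lie_comb A B c0 c1 c2 c3 :
  val A *m comb A B c0 c1 c2 c3 - comb A B c0 c1 c2 c3 *m val A =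
  (c2%:M + c3 *: sqr_mx A) *m (val A *m comm_mx A B - comm_mx A B *m val A).
Proof.
rewrite /comb; move: (comm_mx A B) => K; rewrite [K]mx2_eta /sqr_mx.
sl2_entries1 A; congr (mx2 _ _ _ _); ring: hA.
Qed.

(** With L = A B - B A, both L and A L are traceless, so L A^-1 = A L and the
    part K B = A B A^-1 of the combination contributes A L A^-1 = A^2 L. *)
Lemma lie_comb_mulb A B c0 c1 c2 c3 :
  val A *m (comb A B c0 c1 c2 c3 *m val B) -
    comb A B c0 c1 c2 c3 *m val B *m val A =
  ((c0 - c3)%:M +
     (c1 + c2 + (sl_beta A + 2%:R) * c3) *: sqr_mx A) *m
    (val A *m val B - val B *m val A).
Proof.
rewrite /comb /comm_mx /sqr_mx /sl_beta.
sl2_entries2 A B; congr (mx2 _ _ _ _); ring: hA hB.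
Qed.

(** As K = A C^-1, the bracket is A (A C^-1 - C^-1 A).  Its determinant is thus
    - gamma(A, C^-1), and Fricke's formula for the trace of a commutator, with
    tr C = tr A and tr (A C^-1) = z + 2, gives gamma(A, C^-1) = z (z - x). *)
Lemma det_lie_comm A B :
  \det (val A *m comm_mx A B - comm_mx A B *m val A) =
  sl_gamma A B * (sl_beta A - sl_gamma A B).
Proof.
rewrite /comm_mx /sl_beta /sl_gamma !SL2_valM !SL2_valV.
sl2_entries2 A B; ring: hA hB.
Qed.

Lemma sl_gamma_comb A B W c0 c1 c2 c3 : val W = comb A B c0 c1 c2 c3 ->
  sl_gamma A W = - (sl_gamma A B * (sl_beta A - sl_gamma A B)
                      * qnorm (sl_beta A) c2 c3).
Proof.
move=> eW; rewrite sl_gamma_det eW lie_comb det_mulmx det_qnorm det_lie_comm.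
by rewrite mulrC.
Qed.

Lemma sl_gamma_comb_mulb A B W c0 c1 c2 c3 :
  val W = comb A B c0 c1 c2 c3 *m val B ->
  sl_gamma A W = sl_gamma A B *
    qnorm (sl_beta A) (c0 - c3) (c1 + c2 + (sl_beta A + 2%:R) * c3).
Proof.
move=> eW; rewrite sl_gamma_det eW lie_comb_mulb det_mulmx det_qnorm.
by rewrite (sl_gamma_det A B) mulNr mulrC.
Qed.

Lemma sl_gamma_mulr A W : sl_gamma A (W * A)%g = sl_gamma A W.
Proof.
by rewrite !sl_gamma_det SL2_valM mulmxA -mulmxBl det_mulmx det_SL2 mulr1.
Qed.

Lemma sl_gammaV A B : sl_gamma A B^-1%g = sl_gamma A B.
Proof.
rewrite /sl_gamma !SL2_valM !SL2_valV.
sl2_entries2 A B; ring: hA hB.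
Qed.

Lemma expgzV (G : groupType) (x : G) n : (expgz x^-1 n = expgz x (- n))%g.
Proof.
case: n => [[|n]|n]; first by [].
  by rewrite -NegzE /= expgVn.
by rewrite NegzE opprK /= expgVn invgK.
Qed.

Lemma word_evalV (G : groupType) (x y : G) s rs :
  word_eval x y^-1%g (gw_syllables s rs) =
  word_eval x y (gw_syllables (- s) rs).
Proof. by elim: rs s => [|r rs IHrs] s; rewrite /= expgzV // IHrs. Qed.

Definition reg_b (w : good_word) (B : SL2 C) : SL2 C :=
  if gw_regular w then B else B^-1%g.

(** Passing to the regular even word changes w(A, B) at most by replacing B with
    B^-1 and by a final factor A; neither affects gamma. *)
Lemma sl_gamma_even_word w A B :
  sl_gamma A (word_eval A B (gw_word w)) =
  sl_gamma A (word_eval A (reg_b w B) (gw_even_word (gw_regularize w))).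
Proof.
have -> : word_eval A B (gw_word w) =
    word_eval A (reg_b w B) (gw_word (gw_regularize w)).
  by case: w => -[] rs; rewrite /gw_word //= word_evalV.
rewrite /gw_even_word; case: ifP => _; first by [].
by rewrite word_eval_cat [word_eval _ _ [:: _]]/= expg1 mulg1 sl_gamma_mulr.
Qed.

Lemma sl_gamma_reg_b w A B : sl_gamma A (reg_b w B) = sl_gamma A B.
Proof. by rewrite /reg_b; case: ifP => _; last exact: sl_gammaV. Qed.

Lemma psl_expgz (A : SL2 C) n : expgz (psl A) n = psl (expgz A n).
Proof.
have pslX k : (psl A ^+ k)%g = psl (A ^+ k)%g.
  elim: k => [|k IHk]; first by rewrite !expg0.
  by rewrite !expgS IHk; exact: PSL2_mulE.
by case: n => k; rewrite /expgz pslX //; exact: PSL2_invE.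
Qed.

Lemma psl_word_eval A B (w : word) :
  word_eval (psl A) (psl B) w = psl (word_eval A B w).
Proof.
elim: w => [|[[] n] w IHw] //=; rewrite IHw psl_expgz; exact: PSL2_mulE.
Qed.

End Gamma.

(** * Half-integral polynomials *)

Section EvalQ.
Variable R : realType.
Local Notation C := R[i].
Implicit Types (x z : C) (p q : {mpoly rat[2]}).

Lemma evalQD p q x z : evalQ (p + q) x z = evalQ p x z + evalQ q x z.
Proof. by rewrite /evalQ !rmorphD. Qed.

Lemma evalQN p x z : evalQ (- p) x z = - evalQ p x z.
Proof. by rewrite /evalQ !rmorphN. Qed.

Lemma evalQM p q x z : evalQ (p * q) x z = evalQ p x z * evalQ q x z.
Proof. by rewrite /evalQ !rmorphM. Qed.

Lemma evalQXn p n x z : evalQ (p ^+ n) x z = evalQ p x z ^+ n.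
Proof. by rewrite /evalQ !rmorphXn. Qed.

Lemma evalQ_nat n x z : evalQ n%:R x z = n%:R.
Proof. by rewrite /evalQ !rmorph_nat. Qed.

Lemma evalQX x z : evalQ polX x z = x.
Proof. by rewrite /evalQ map_mpolyX mevalXU. Qed.

Lemma evalQZ x z : evalQ polZ x z = z.
Proof. by rewrite /evalQ map_mpolyX mevalXU. Qed.

Definition evalQE :=
  (evalQD, evalQN, evalQM, evalQXn, evalQX, evalQZ, evalQ_nat).

Lemma map_mpoly_ratr_int (p : {mpoly int[2]}) :
  map_mpoly (ratr : rat -> C) (map_mpoly (intr : int -> rat) p) =
  map_mpoly (intr : int -> C) p.
Proof.
apply/mpolyP => m; rewrite [LHS]mcoeff_map_mpoly [RHS]mcoeff_map_mpoly.
rewrite mcoeff_map_mpoly; exact: ratr_int.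
Qed.

Lemma evalQ_int (p : {mpoly int[2]}) x z :
  evalQ (map_mpoly (intr : int -> rat) p) x z = evalZ p x z.
Proof. by rewrite /evalQ map_mpoly_ratr_int. Qed.

Definition half (p : {mpoly int[2]}) : {mpoly rat[2]} :=
  2%:R^-1 *: map_mpoly (intr : int -> rat) p.

Lemma evalQ_half (q : {mpoly int[2]}) x z :
  evalQ (half q) x z = evalZ q x z / 2%:R.
Proof.
by rewrite mulrC -evalQ_int /evalQ map_mpolyZ mevalZ fmorphV rmorph_nat.
Qed.

Lemma half_integral_half (q : {mpoly int[2]}) : half_integral (half q).
Proof.
move=> m; rewrite mcoeffZ mcoeff_map_mpoly mulrA mulfV // mul1r.
exact: Num.Theory.intr_int.
Qed.

End EvalQ.

(** * Canonical matrices *)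

Section Canonical.
Variable R : realType.
Local Notation C := R[i].

Variables (beta beta' gamma b c : C) (A B : SL2 C).
Let a := canon_a beta beta' gamma.
Let d := canon_d beta beta' gamma.
Let Q := canonQ beta.
Hypotheses (beta_neq0 : beta != 0) (hbc : canon_bc beta gamma b c).
Hypotheses (eA : val A = canonA beta) (eB : val B = mx2 a b c d).

(** mu and muV are the eigenvalues of A^2. *)
Definition mu : C := (beta + 2%:R + Q) / 2%:R.
Definition muV : C := (beta + 2%:R - Q) / 2%:R.

Let sqrQ : Q ^+ 2 = beta * (beta + 4%:R).
Proof. exact: sqr_sqrtc. Qed.

Lemma canon_sqr_mx : sqr_mx A = mx2 mu 0 0 muV.
Proof.
rewrite /sqr_mx eA /canonA mul_mx2 /mu /muV -/Q.
have s0 : sqrtc beta != 0 by rewrite sqrtc_eq0.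
have e := sqr_sqrtc beta; have hQ := sqrQ.
by congr (mx2 _ _ _ _); field : e hQ.
Qed.

Lemma canon_beta : sl_beta A = beta.
Proof.
rewrite /sl_beta eA tr_mx2 -/Q.
have s0 : sqrtc beta != 0 by rewrite sqrtc_eq0.
have e := sqr_sqrtc beta; have hQ := sqrQ.
by field : e hQ.
Qed.

Let bc : b * c = - (gamma / beta).
Proof. exact: canon_bcE. Qed.

Let ad : a * d = 1 + b * c.
Proof. by have/eqP := det_SL2 B; rewrite eB det_mx2 subr_eq => /eqP. Qed.

Lemma canon_comm_mx : comm_mx A B =
  mx2 (1 + gamma / beta * (mu - 1)) (a * b * (mu - 1))
      (c * d * (muV - 1)) (1 + gamma / beta * (muV - 1)).
Proof.
have -> : gamma / beta = - (b * c) by rewrite bc opprK.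
rewrite /comm_mx eA eB /canonA !mx2E /mu /muV -/Q.
have s0 : sqrtc beta != 0 by rewrite sqrtc_eq0.
have e := sqr_sqrtc beta; have hQ := sqrQ.
by congr (mx2 _ _ _ _); field : e hQ ad.
Qed.

Lemma canon_gamma : sl_gamma A B = gamma.
Proof.
rewrite /sl_gamma !SL2_valM !SL2_valV -/(comm_mx A B) canon_comm_mx tr_mx2.
rewrite /mu /muV; by field.
Qed.

End Canonical.

(** * Existence of the polynomials of a word *)

(** Obtained by expanding the entries of q0 + q1 S + q2 K + q3 S K at the
    canonical matrices, where S = diag(mu, mu^-1) with mu = (x + 2 + Q)/2 and K
    has upper row 1 + (z/x) (mu - 1), a b (mu - 1); the products are reduced
    with Q^2 = x (x + 4). *)
Definition balanced_polys (q0 q1 q2 q3 : {mpoly int[2]}) : word_polys :=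
  WordPolys
    (half (2%:R * q0 + (polX + 2%:R) * q1 + (polZ + 2%:R) * q2
             + (polX + 2%:R + polZ * (polX + 3%:R)) * q3))
    (half (polX * q1 + polZ * q2 + (polX + polZ * (polX + 1)) * q3))
    (half (q2 + (polX + 3%:R) * q3))
    (half (q2 + (polX + 1) * q3)).

(** Here (q0 + q1 S + q2 K + q3 S K) B = (q0 + q1 S) B + (q2 + q3 S) A B A^-1,
    and A B A^-1 has upper row a, b mu. *)
Definition unbalanced_polys (q0 q1 q2 q3 : {mpoly int[2]}) : word_polys :=
  let u := q1 + q2 + (polX + 2%:R) * q3 in
  WordPolys
    (half (2%:R * (q0 + q2) + (polX + 2%:R) * (q1 + q3)))
    (half (q1 + q3))
    (half (2%:R * (q0 - q3) + (polX + 2%:R) * u))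
    (half u).

Section Represents.
Variable R : realType.
Local Notation C := R[i].

Lemma canon_comb (beta beta' gamma b c : C) (A B : SL2 C) (q0 q1 q2 q3 : C) :
  let a := canon_a beta beta' gamma in
  let d := canon_d beta beta' gamma in
  let m := mu beta in
  let m' := muV beta in
  let g := gamma / beta in
  beta != 0 -> canon_bc beta gamma b c ->
  val A = canonA beta -> val B = mx2 a b c d ->
  comb A B q0 q1 q2 q3 =
    mx2 (q0 + q1 * m + (q2 + q3 * m) * (1 + g * (m - 1)))
        ((q2 + q3 * m) * (a * b * (m - 1)))
        ((q2 + q3 * m') * (c * d * (m' - 1)))
        (q0 + q1 * m' + (q2 + q3 * m') * (1 + g * (m' - 1))).
Proof.
move=> a d m m' g b0 hbc eA eB.
rewrite /comb (canon_sqr_mx b0 eA) (canon_comm_mx b0 hbc eA eB) !mx2E.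
by rewrite -/m -/m' -/g -/a -/d; congr (mx2 _ _ _ _); ring.
Qed.

Lemma balanced_represents w q0 q1 q2 q3 : gw_balanced w ->
  even_word_comb R w q0 q1 q2 q3 ->
  represents R true (gw_even_word (gw_regularize w))
    (balanced_polys q0 q1 q2 q3).
Proof.
move=> bal hq beta beta' gamma b c A B a d b0 hbc eA eB.
rewrite hq bal mulmx1 (canon_comb _ _ _ _ b0 hbc eA eB).
rewrite (canon_beta b0 eA) (canon_gamma b0 hbc eA eB).
rewrite /balanced_mx /= !evalQ_half !evalZE /mu /muV -/a -/d.
have hQ : canonQ beta ^+ 2 = beta * (beta + 4%:R) by exact: sqr_sqrtc.
move: (evalZ q0 _ _) (evalZ q1 _ _) => c0 c1.
move: (evalZ q2 _ _) (evalZ q3 _ _) => c2 c3.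
by congr (mx2 _ _ _ _); field : hQ.
Qed.

Lemma unbalanced_represents w q0 q1 q2 q3 : ~~ gw_balanced w ->
  even_word_comb R w q0 q1 q2 q3 ->
  represents R false (gw_even_word (gw_regularize w))
    (unbalanced_polys q0 q1 q2 q3).
Proof.
move=> /negbTE unbal hq beta beta' gamma b c A B a d b0 hbc eA eB.
rewrite hq unbal (canon_comb _ _ _ _ b0 hbc eA eB) eB mul_mx2.
rewrite (canon_beta b0 eA) (canon_gamma b0 hbc eA eB).
rewrite /unbalanced_mx /= !evalQ_half !evalZE /mu /muV -/a -/d.
have hQ : canonQ beta ^+ 2 = beta * (beta + 4%:R) by exact: sqr_sqrtc.
have -> : gamma / beta = - (b * c) by rewrite (canon_bcE hbc) opprK.
have ad : a * d = 1 + b * c.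
  by have/eqP := det_SL2 B; rewrite eB det_mx2 subr_eq => /eqP.
move: (evalZ q0 _ _) (evalZ q1 _ _) => c0 c1.
move: (evalZ q2 _ _) (evalZ q3 _ _) => c2 c3.
by congr (mx2 _ _ _ _); field : hQ ad.
Qed.

Lemma polys_spec_exists w : exists P, polys_spec R w P.
Proof.
have [q0 [q1 [q2 [q3 hq]]]] := even_word_combP R w.
have [bal|unbal] := boolP (gw_balanced w).
  exists (balanced_polys q0 q1 q2 q3); split.
    by split; exact: half_integral_half.
  by rewrite bal; exact: balanced_represents.
exists (unbalanced_polys q0 q1 q2 q3); split.
  by split; exact: half_integral_half.
by rewrite (negbTE unbal); exact: unbalanced_represents.
Qed.

Lemma polys_ofP w : polys_spec R w (polys_of R w).
Proof.
rewrite /polys_of; case: pselect => [exP|[]]; last exact: polys_spec_exists.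
exact: projT2 (cid exP).
Qed.

End Represents.

(** * Polynomials that vanish on a grid *)

Section Vanishing.

Lemma poly_eq0_nat_roots (D : idomainType) (p : {poly D}) :
  injective (fun n : nat => n%:R : D) -> (forall n, p.[n.+1%:R] = 0) -> p = 0.
Proof.
move=> inj p0; apply: (@roots_geq_poly_eq0 _ _
  [seq n.+1%:R | n <- iota 0 (size p)]).
- by apply/allP => _ /mapP[n _ ->]; apply/rootP.
- rewrite map_inj_uniq ?iota_uniq // => i j /inj.
  by case.
- by rewrite size_map size_iota.
Qed.

Lemma mpoly2_eq0 (D : idomainType) (q : {mpoly D[2]}) :
  injective (fun n : nat => n%:R : D) ->
  (forall m n : nat, q.@[xz_point m.+1%:R n.+1%:R] = 0) -> q = 0.
Proof.
move=> inj q0.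
(* q as a polynomial in x over the polynomials in z. *)
pose P : {poly {poly D}} :=
  \sum_(m <- msupp q) (q@_m *: 'X^(m 1)) *: 'X^(m 0).
have P0 : P = 0.
  apply: poly_eq0_nat_roots => [i j /= /(congr1 (coefp 0)) | m].
    by rewrite /= -!polyC_natr !coefC /=; exact: inj.
  apply: poly_eq0_nat_roots => // n; rewrite -(q0 m n) mevalE.
  rewrite /P !horner_sum; apply: eq_bigr => k _.
  rewrite -polyC_natr hornerZ hornerXn -polyC_exp hornerM hornerC.
  rewrite hornerZ hornerXn.
  have lift1 : lift ord0 ord0 = 1 :> 'I_2 by exact/val_inj.
  rewrite !big_ord_recl big_ord0 mulr1 /xz_point /= lift1.
  by rewrite mulrAC mulrA.
apply/mpolyP => k; rewrite mcoeff0.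
have := congr1 (fun p : {poly {poly D}} => p`_(k 0)`_(k 1)) P0.
rewrite !coef0 => <-; rewrite /P !coef_sum {1}[q]mpolyE raddf_sum /=.
apply: eq_bigr => m _; rewrite mcoeffZ mcoeffX coefZ coefXn.
rewrite -polyC_natr coefMC coefZ coefXn.
rewrite -mulrA; congr (_ * _).
have -> : (m == k) = (k 1 == m 1) && (k 0 == m 0).
  apply/eqP/andP => [-> // | [/eqP e1 /eqP e0]].
  by apply/mnmP => i; case: (ord2P i) => ->.
by case: (_ == _ :> nat); case: (_ == _ :> nat);
  rewrite /= ?mulr1 ?mulr0 ?mul0r.
Qed.

Lemma evalQ_inj (R : realType) (p q : {mpoly rat[2]}) :
  (forall x z : R[i], x != 0 -> evalQ p x z = evalQ q x z) -> p = q.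
Proof.
move=> epq; apply/eqP; rewrite -subr_eq0; apply/eqP/mpolyP => m.
rewrite mcoeff0.
have natI : injective (fun n : nat => n%:R : R[i]).
  by move=> i j /= /eqP; rewrite Num.Theory.eqr_nat => /eqP.
have : map_mpoly (ratr : rat -> R[i]) (p - q) = 0.
  apply: mpoly2_eq0 natI _ => k n.
  have := epq k.+1%:R n.+1%:R; rewrite Num.Theory.pnatr_eq0 => /(_ isT) e.
  by rewrite -/(evalQ _ _ _) evalQD evalQN e subrr.
move=> /(congr1 (mcoeff m)); rewrite mcoeff_map_mpoly mcoeff0 => /eqP.
by rewrite fmorph_eq0 => /eqP.
Qed.

End Vanishing.

(** * Comparison of the two formulas *)

Section Main.
Variable R : realType.
Local Notation C := R[i].

Lemma canon_pair (beta gamma : C) : beta != 0 ->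
  exists b c (A B : SL2 C), [/\ canon_bc beta gamma b c, val A = canonA beta &
    val B = mx2 (canon_a beta 0 gamma) b c (canon_d beta 0 gamma)].
Proof.
move=> b0.
have [b [c hbc]] : exists b c : C, canon_bc beta gamma b c.
  rewrite /canon_bc; case: (gamma == 0); first by exists 0, 0; apply: Or33.
  by exists (- sqrtc (gamma / beta)), (sqrtc (gamma / beta)).
have /eqP dA := det_canonA b0; have /eqP dB := det_canonB 0 b0 hbc.
by exists b, c, (MkSL2 dA), (MkSL2 dB).
Qed.

Lemma sl_gamma_canon (beta p q u v : C) (A W : SL2 C) : beta != 0 ->
  val A = canonA beta -> val W = mx2 p q u v ->
  sl_gamma A W = - (beta * (q * u)).
Proof.
move=> b0 eA eW; rewrite sl_gamma_det eA eW /canonA !mx2E det_mx2.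
have s0 : sqrtc beta != 0 by rewrite sqrtc_eq0.
have e := sqr_sqrtc beta.
by field : e.
Qed.

Definition gamma_poly (balanced : bool) (P : word_polys) : {mpoly rat[2]} :=
  if balanced then
    polZ * (polX - polZ) *
      (polX * wp_t P ^+ 2 - (polX + 4%:R) * wp_omega P ^+ 2)
  else polZ * (wp_t P ^+ 2 - polX * (polX + 4%:R) * wp_omega P ^+ 2).

(** Any quadruple in the canonical matrix identity yields gamma(A, W), hence the
    trace polynomial, at every point with beta != 0, which is a Zariski dense
    set of values of (beta, gamma). *)
Lemma represents_gamma balanced W P (p : {mpoly int[2]}) :
  represents R balanced W P ->
  (forall A B : SL2 C, sl_gamma A (word_eval A B W) =
     evalZ p (sl_beta A) (sl_gamma A B)) ->
  map_mpoly (intr : int -> rat) p = gamma_poly balanced P.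
Proof.
move=> repr hp; apply: (@evalQ_inj R) => beta gamma b0.
have [b [c [A [B [hbc eA eB]]]]] := canon_pair gamma b0.
rewrite evalQ_int -{1}(canon_beta b0 eA) -{1}(canon_gamma b0 hbc eA eB) -hp.
have eW := repr beta 0 gamma b c A B b0 hbc eA eB.
have hQ : canonQ beta ^+ 2 = beta * (beta + 4%:R) by exact: sqr_sqrtc.
have bc := canon_bcE hbc.
have ad : canon_a beta 0 gamma * canon_d beta 0 gamma = 1 + b * c.
  by have/eqP := det_SL2 B; rewrite eB det_mx2 subr_eq => /eqP.
rewrite /gamma_poly; case: balanced eW {repr} => eW;
  rewrite (sl_gamma_canon b0 eA eW) !evalQE;
  move: (evalQ (wp_t P) _ _) (evalQ (wp_omega P) _ _) => t o;
  move: (canon_a beta 0 gamma) (canon_d beta 0 gamma) ad => a d ad;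
  have -> : gamma = - (b * c * beta) by rewrite bc; field.
- by ring : hQ ad.
- by ring : hQ ad.
Qed.

Lemma sl_gamma_good_word (w : good_word) : exists p : {mpoly int[2]},
  forall A B : SL2 C,
    sl_gamma A (word_eval A B (gw_even_word (gw_regularize w))) =
    evalZ p (sl_beta A) (sl_gamma A B).
Proof.
have [q0 [q1 [q2 [q3 hq]]]] := even_word_combP R w.
pose N e f : {mpoly int[2]} := e ^+ 2 + (polX + 2%:R) * e * f + f ^+ 2.
have evN e f x z : evalZ (N e f) x z = qnorm x (evalZ e x z) (evalZ f x z) :> C.
  by rewrite /N 2!evalZD !evalZXn !evalZM (evalZD polX) evalZX evalZ_nat.
have [bal|unbal] := boolP (gw_balanced w).
  exists (- (polZ * (polX - polZ) * N q2 q3)) => A B.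
  rewrite evalZN 2!evalZM evN evalZD evalZN evalZX evalZZ; apply: sl_gamma_comb.
  by rewrite hq bal mulmx1.
exists (polZ * N (q0 - q3) (q1 + q2 + (polX + 2%:R) * q3)) => A B.
rewrite evalZM evN evalZZ !evalZE; apply: sl_gamma_comb_mulb.
by rewrite hq (negbTE unbal).
Qed.

End Main.

Theorem theorem5p3 (R : realType) (w : good_word) :
  exists p : {mpoly int[2]},
    [/\ forall f g : IsomH3 R,
          psl_gamma f (word_eval f g (gw_word w)) =
            evalZ p (psl_beta f) (psl_gamma f g),
        gw_balanced w ->
          map_mpoly (intr : int -> rat) p =
            polZ * (polX - polZ) *
              (polX * t_of R w ^+ 2 - (polX + 4%:R) * omega_of R w ^+ 2)
      & ~~ gw_balanced w ->
          map_mpoly (intr : int -> rat) p =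
            polZ *
              (t_of R w ^+ 2 - polX * (polX + 4%:R) * omega_of R w ^+ 2)].
Proof.
have [p hp] := sl_gamma_good_word R w.
have [_ /represents_gamma/(_ hp) pE] := polys_ofP R w.
exists p; split=> [f g|bal|unbal]; first last.
- by rewrite pE (negbTE unbal).
- by rewrite pE bal.
rewrite -(psl_repr f) -(psl_repr g) psl_word_eval !psl_gammaE psl_betaE.
by rewrite sl_gamma_even_word hp sl_gamma_reg_b.
Qed.
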